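(* For the Frail Fighter ($u=0$), property [A] holds: for every fixed $n\ge 1$, $K(n,t)$ is non-increasing in $t$, $t\ge 0$.
   Context: Fighter problem with discrete ammunition. Fix $u\in[0,1]$ and a sequence of probabilities $0=a(0)<a(1)<a(2)<\cdots$ (each $a(j)\in[0,1]$) that is strictly increasing and concave, i.e. $a(j+2)-a(j+1)\le a(j+1)-a(j)$ for all $j\ge 0$. Here $a(j)$ is the probability that an enemy plane is shot down when $j$ missiles are spent on it; if it is not shot down, the fighter survives with probability $u$; enemies arrive according to a Poisson process of rate $1$. Put $c(j)=a(j)+u(1-a(j))$. For $t\ge 0$ (remaining flying time) define inductively on $n$: $N(0,t)=0$; for $r\ge 0$, $N^*(r,t)=e^{-t}\int_0^t N(r,x)e^x\,dx$ (so $N^*(0,t)=0$); for $n\ge 1$ and $1\le j\le n$, $N_n(j,t)=a(j)+c(j)N^*(n-j,t)$; and $N(n,t)=\max_{1\le j\le n}N_n(j,t)$. The optimal spending policy (smallest optimal number of missiles) is, for $n\ge1$, $K(n,t)=\min\{j\in\{1,\dots,n\}: N_n(j,t)=\max_{1\le i\le n}N_n(i,t)\}$. The Frail Fighter is the case $u=0$, for which $c(j)=a(j)$ and $N_n(j,t)=a(j)[1+N^*(n-j,t)]$. *)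

(* Defs.v *)
From Stdlib Require Import Reals RList List Lia Lra.
From Coquelicot Require Import Coquelicot.
Open Scope R_scope.

Definition kill_prob (a : nat -> R) : Prop :=
  a 0%nat = 0 /\
  (forall j, 0 <= a j <= 1) /\
  (forall j, a j < a (S j)) /\
  (forall j, a (S (S j)) - a (S j) <= a (S j) - a j).

Definition c (a : nat -> R) (u : R) (j : nat) : R := a j + u * (1 - a j).

Definition star (f : R -> R) (t : R) : R :=
  exp (- t) * RInt (fun x => f x * exp x) 0 t.

Definition max_between (m : nat) (f : nat -> R) : R := MaxRlist (map f (seq 1 m)).

(* [history a u n] is the list N(n,.), N(n-1,.), ..., N(0,.), so that
   N(n-j,.) is its entry of index [j], and in the recursive call
   N(S n - j,.) is the entry of index [j - 1]. *)
Fixpoint history (a : nat -> R) (u : R) (n : nat) : list (R -> R) :=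
  match n with
  | O => (fun _ => 0) :: nil
  | S m =>
      (fun t => max_between (S m) (fun j =>
         a j + c a u j * star (nth (j - 1) (history a u m) (fun _ => 0)) t))
      :: history a u m
  end.

(* N(n,t) *)
Definition value (a : nat -> R) (u : R) (n : nat) : R -> R :=
  nth 0 (history a u n) (fun _ => 0).

(* N^*(r,t) *)
Definition value_star (a : nat -> R) (u : R) (r : nat) (t : R) : R :=
  star (value a u r) t.

(* N_n(j,t) *)
Definition value_spend (a : nat -> R) (u : R) (n j : nat) (t : R) : R :=
  a j + c a u j * value_star a u (n - j) t.

(* The default 0 is never reached when n >= 1, see [K_spec]. *)
Definition K (a : nat -> R) (u : R) (n : nat) (t : R) : nat :=
  match find (fun j => if Req_dec_T (value_spend a u n j t)
                            (max_between n (fun i => value_spend a u n i t))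
                       then true else false) (seq 1 n) with
  | Some j => j
  | None => 0%nat
  end.

Lemma max_between_ext m f g :
  (forall j, (1 <= j <= m)%nat -> f j = g j) -> max_between m f = max_between m g.
Proof.
  intros H; unfold max_between; f_equal; apply map_ext_in.
  intros j Hj; apply in_seq in Hj; apply H; lia.
Qed.

Lemma max_between_ge m f j : (1 <= j <= m)%nat -> f j <= max_between m f.
Proof.
  intros H; apply MaxRlist_P1, in_map, in_seq; lia.
Qed.

Lemma max_between_attained m f :
  (1 <= m)%nat -> exists j, (1 <= j <= m)%nat /\ f j = max_between m f.
Proof.
  intros H.
  assert (Hin : In (max_between m f) (map f (seq 1 m))).
  { apply MaxRlist_P2; exists (f 1%nat); apply in_map, in_seq; lia. }
  apply in_map_iff in Hin; destruct Hin as [j [E Hj]]; apply in_seq in Hj.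
  exists j; split; [lia | exact E].
Qed.

Lemma nth_history a u n i :
  (i <= n)%nat -> nth i (history a u n) (fun _ => 0) = value a u (n - i).
Proof.
  revert i; induction n as [|n IH]; intros [|i] Hi; try reflexivity; try lia.
  simpl; apply IH; lia.
Qed.

Lemma value_0 a u t : value a u 0 t = 0.
Proof. reflexivity. Qed.

Lemma value_max a u n t : (1 <= n)%nat ->
  value a u n t = max_between n (fun j => value_spend a u n j t).
Proof.
  destruct n as [|m]; [lia | intros _].
  apply max_between_ext; intros j Hj.
  unfold value_spend, value_star; rewrite nth_history by lia.
  replace (m - (j - 1))%nat with (S m - j)%nat by lia; reflexivity.
Qed.

Lemma find_seq_least p s m j : find p (seq s m) = Some j ->
  (s <= j < s + m)%nat /\ p j = true /\
  (forall i, (s <= i < j)%nat -> p i = false).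
Proof.
  revert s; induction m as [|m IH]; intros s H; simpl in H; [discriminate|].
  destruct (p s) eqn:E.
  - injection H as <-; repeat split; try lia; auto; intros; lia.
  - destruct (IH _ H) as [H1 [H2 H3]]; repeat split; try lia; auto.
    intros i Hi; destruct (Nat.eq_dec i s) as [->|]; auto; apply H3; lia.
Qed.

Lemma K_spec a u n t : (1 <= n)%nat ->
  (1 <= K a u n t <= n)%nat /\
  value_spend a u n (K a u n t) t = value a u n t /\
  (forall j, (1 <= j <= n)%nat -> value_spend a u n j t = value a u n t ->
     (K a u n t <= j)%nat).
Proof.
  intros Hn; rewrite (value_max a u n t Hn); unfold K.
  set (M := max_between n (fun i => value_spend a u n i t)).
  set (p := fun j => if Req_dec_T (value_spend a u n j t) M then true else false).
  destruct (find p (seq 1 n)) as [k|] eqn:E.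
  - destruct (find_seq_least _ _ _ _ E) as [H1 [H2 H3]].
    split; [lia | split].
    + unfold p in H2; destruct (Req_dec_T (value_spend a u n k t) M); [assumption | discriminate].
    + intros j Hj Ej; destruct (Nat.le_gt_cases k j) as [|Hlt]; [assumption|].
      specialize (H3 j ltac:(lia)); unfold p in H3.
      destruct (Req_dec_T (value_spend a u n j t) M); [discriminate | contradiction].
  - exfalso.
    destruct (max_between_attained n (fun i => value_spend a u n i t) Hn) as [j [Hj Ej]].
    assert (F := find_none _ _ E j ltac:(apply in_seq; lia)); unfold p in F.
    destruct (Req_dec_T (value_spend a u n j t) M); [discriminate | contradiction].
Qed.

(* Main.v *)
Require Import Defs.
From Stdlib Require Import Reals RList List Lia Lra.
From Coquelicot Require Import Coquelicot.
Open Scope R_scope.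

(** Write [f r t = 1 + N^*(r,t)], so that [N_n(j,t) = a(j) f (n-j) t] when
    [u = 0].  Property [A] follows as soon as [f r' / f r] is non-decreasing in
    [t] for [r <= r'].  Since [exp t * f r t = 1 + int_0^t (1 + N(r,x)) exp x dx],
    this holds for [r' = r + 1] if [(1 + N(r+1,t)) / (1 + N(r,t))] is
    non-decreasing in [t].  To get [(1 + N(r+1,s)) (1 + N(r,t)) <=
    (1 + N(r+1,t)) (1 + N(r,s))] for [s <= t], let [k] be optimal for [(r+1,s)]
    and [j] for [(r,t)].  If [k <= j+1], keep spending [k] and [j] on the right
    and use the induction hypothesis, as [r+1-k >= r-j].  Otherwise spend [j+1]
    in [(r+1,t)] and [k-1] in [(r,s)], and use the concavity of [a]. *)

(** * Continuity of the value functions in time *)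

Lemma continuous_Rmax (f g : R -> R) (x : R) :
  continuous f x -> continuous g x -> continuous (fun t => Rmax (f t) (g t)) x.
Proof.
  intros Hf Hg.
  (* The maximum is half of the sum plus the absolute difference. *)
  apply continuous_ext with (fun t => (f t + g t + Rabs (f t - g t)) * / 2).
  { intros t; unfold Rmax, Rabs.
    destruct (Rle_dec (f t) (g t)), (Rcase_abs (f t - g t)); lra. }
  apply (continuous_mult (fun t => f t + g t + Rabs (f t - g t)) (fun _ => / 2));
    [|apply continuous_const].
  apply (continuous_plus (fun t => f t + g t)); [now apply (continuous_plus f g)|].
  apply (continuous_comp (fun t => f t - g t) Rabs);
    [now apply (continuous_minus f g) | apply continuous_Rabs].
Qed.

Lemma continuous_MaxRlist (F : nat -> R -> R) (l : list nat) (x : R) :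
  (forall j, In j l -> continuous (F j) x) ->
  continuous (fun t => MaxRlist (map (fun j => F j t) l)) x.
Proof.
  induction l as [|i [|k l] IH]; intros H.
  - apply continuous_const.
  - apply (H i); simpl; auto.
  - apply (continuous_Rmax (F i) (fun t => MaxRlist (map (fun j => F j t) (k :: l)))).
    + apply H; simpl; auto.
    + apply IH; intros j Hj; apply H; simpl in *; auto.
Qed.

Lemma ex_RInt_continuous_everywhere (f : R -> R) (b c : R) :
  (forall x, continuous f x) -> ex_RInt f b c.
Proof. intros H; apply (ex_RInt_continuous f); auto. Qed.

Lemma continuous_mult_exp (f : R -> R) (x : R) :
  continuous f x -> continuous (fun y => f y * exp y) x.
Proof.
  intros H; apply (continuous_mult f exp); [exact H | apply continuous_exp].
Qed.

Lemma continuous_star (f : R -> R) (x : R) :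
  (forall y, continuous f y) -> continuous (star f) x.
Proof.
  intros H; unfold star.
  apply (continuous_mult (fun t => exp (- t)) (fun t => RInt (fun x => f x * exp x) 0 t)).
  - apply (continuous_comp Ropp exp);
      [apply (continuous_opp (fun t : R => t)), continuous_id | apply continuous_exp].
  - assert (H' : forall y, continuous (fun y => f y * exp y) y)
      by (intros y; now apply continuous_mult_exp).
    apply (continuous_RInt_1 (fun x => f x * exp x) 0 x (fun t => RInt (fun x => f x * exp x) 0 t)).
    exists (mkposreal 1 Rlt_0_1); intros z _.
    apply (RInt_correct (fun x => f x * exp x)).
    now apply ex_RInt_continuous_everywhere.
Qed.

(** Makes every integral below exist. The induction is strong because [N(n,.)] refers to all
    [N(n-j,.)] with [j >= 1]. *)
Lemma continuous_value (a : nat -> R) (u : R) (n : nat) (x : R) :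
  continuous (value a u n) x.
Proof.
  revert x; induction n as [n IH] using (well_founded_induction Wf_nat.lt_wf); intros x.
  destruct n as [|m]; [apply continuous_const|].
  apply continuous_ext
    with (fun t => max_between (S m) (fun j => value_spend a u (S m) j t)).
  { intros t; symmetry; apply value_max; lia. }
  apply continuous_MaxRlist; intros j Hj; apply in_seq in Hj.
  apply (continuous_plus (fun _ => a j)); [apply continuous_const|].
  apply (continuous_mult (fun _ => c a u j)); [apply continuous_const|].
  apply continuous_star; intros y; apply IH; lia.
Qed.

(** * Integrals *)

(** The ratio [q s / p s] separates the two pieces: [q / p] is at most this on [[0,s]] and at least
    this on [[s,t]]. The summands 1 have ratio 1, which [p s <= q s] also puts below it. *)
Lemma ratio_of_integrals_nondecreasing (p q : R -> R) (s t : R) :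
  (forall x, continuous p x) -> (forall x, continuous q x) ->
  (forall x, 0 <= x -> 0 < p x) ->
  (forall x, 0 <= x -> p x <= q x) ->
  (forall x y, 0 <= x -> x <= y -> q x * p y <= q y * p x) ->
  0 <= s -> s <= t ->
  (1 + RInt p 0 t) * (1 + RInt q 0 s) <= (1 + RInt p 0 s) * (1 + RInt q 0 t).
Proof.
  intros Cp Cq Pp Hpq Hmono Hs Hst.
  assert (Ip := fun b c => ex_RInt_continuous_everywhere p b c Cp).
  assert (Iq := fun b c => ex_RInt_continuous_everywhere q b c Cq).
  assert (Escal : forall g b c k, (forall b c, ex_RInt g b c) ->
    RInt (fun x => k * g x) b c = k * RInt g b c)
    by (intros g b c k Hg; apply (RInt_scal g); auto).
  assert (Iscal : forall g b c k, (forall b c, ex_RInt g b c) ->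
    ex_RInt (fun x => k * g x) b c)
    by (intros g b c k Hg; apply (ex_RInt_scal g); auto).
  assert (Hlo : p s * RInt q 0 s <= q s * RInt p 0 s).
  { rewrite <- !Escal by auto.
    apply RInt_le; auto; intros x Hx.
    generalize (Hmono x s); lra. }
  assert (Hhi : q s * RInt p s t <= p s * RInt q s t).
  { rewrite <- !Escal by auto.
    apply RInt_le; auto; intros x Hx.
    generalize (Hmono s x); lra. }
  assert (Ep : RInt p 0 t = RInt p 0 s + RInt p s t)
    by (symmetry; apply (RInt_Chasles p); auto).
  assert (Eq : RInt q 0 t = RInt q 0 s + RInt q s t)
    by (symmetry; apply (RInt_Chasles q); auto).
  assert (P0 : 0 <= RInt p 0 s) by (apply RInt_ge_0; auto; intros; apply Rlt_le, Pp; lra).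
  assert (P1 : 0 <= RInt p s t) by (apply RInt_ge_0; auto; intros; apply Rlt_le, Pp; lra).
  rewrite Ep, Eq.
  generalize (Pp s Hs) (Hpq s Hs); intros Pps Hpqs.
  set (A := RInt p 0 s) in *; set (B := RInt q 0 s) in *.
  set (A' := RInt p s t) in *; set (B' := RInt q s t) in *.
  apply (Rmult_le_reg_l (p s)); [exact Pps|].
  assert (H1 := Rmult_le_compat_l (1 + A) _ _ ltac:(lra) Hhi).
  assert (H2 : A' * (p s * (1 + B)) <= A' * (q s * (1 + A)))
    by (apply Rmult_le_compat_l; lra).
  lra.
Qed.

Lemma is_RInt_exp (t : R) : is_RInt exp 0 t (exp t - 1).
Proof.
  rewrite <- exp_0.
  apply (is_RInt_derive exp exp); intros; [apply is_derive_exp | apply continuous_exp].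
Qed.

(** * Monotonicity and concavity of the kill probabilities *)

Lemma kill_prob_0 (a : nat -> R) : kill_prob a -> a 0%nat = 0.
Proof. intros ha; apply ha. Qed.

Lemma kill_prob_ge0 (a : nat -> R) (j : nat) : kill_prob a -> 0 <= a j.
Proof. intros ha; apply ha. Qed.

Lemma kill_prob_le (a : nat -> R) (j k : nat) :
  kill_prob a -> (j <= k)%nat -> a j <= a k.
Proof.
  intros ha; induction 1 as [|k _ IH]; [lra|].
  assert (a k < a (S k)) by apply ha; lra.
Qed.

Lemma kill_prob_concave (a : nat -> R) (j k : nat) :
  kill_prob a -> (j <= k)%nat -> a (S k) - a k <= a (S j) - a j.
Proof.
  intros ha; induction 1 as [|k _ IH]; [lra|].
  assert (a (S (S k)) - a (S k) <= a (S k) - a k) by apply ha; lra.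
Qed.

(** Subtracting [a j * a k] from both sides leaves [(a (S k) - a k) * a j <= (a (S j) - a j) * a k],
    where both factors on the left are the smaller ones. *)
Lemma kill_prob_log_concave (a : nat -> R) (j k : nat) :
  kill_prob a -> (j <= k)%nat -> a (S k) * a j <= a (S j) * a k.
Proof.
  intros ha H.
  generalize (kill_prob_le a j k ha H) (kill_prob_le a j (S j) ha ltac:(lia))
    (kill_prob_concave a j k ha H) (kill_prob_ge0 a j ha); nra.
Qed.

(** * The factor of the Frail Fighter's future *)

Definition frail_factor (a : nat -> R) (r : nat) (t : R) : R := 1 + value_star a 0 r t.

Lemma frail_spend (a : nat -> R) (n j : nat) (t : R) :
  value_spend a 0 n j t = a j * frail_factor a (n - j) t.
Proof. unfold value_spend, c, frail_factor; ring. Qed.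

Lemma frail_value_ge (a : nat -> R) (n j : nat) (t : R) :
  (1 <= j <= n)%nat -> a j * frail_factor a (n - j) t <= value a 0 n t.
Proof.
  intros H; rewrite <- frail_spend, value_max by lia.
  now apply (max_between_ge n (fun j => value_spend a 0 n j t)).
Qed.

Lemma frail_value_attained (a : nat -> R) (n : nat) (t : R) : (1 <= n)%nat ->
  exists j, (1 <= j <= n)%nat /\ value a 0 n t = a j * frail_factor a (n - j) t.
Proof.
  intros H; destruct (K_spec a 0 n t H) as [Hk [E _]].
  exists (K a 0 n t); now rewrite <- frail_spend.
Qed.

(** Since [exp t = 1 + int_0^t exp], the summand 1 of the factor moves into the integrand; the
    result has the shape needed for comparing ratios of integrals. *)
Lemma exp_mult_frail_factor (a : nat -> R) (r : nat) (t : R) :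
  exp t * frail_factor a r t = 1 + RInt (fun x => (1 + value a 0 r x) * exp x) 0 t.
Proof.
  assert (IN : ex_RInt (fun x => value a 0 r x * exp x) 0 t).
  { apply ex_RInt_continuous_everywhere; intros.
    apply continuous_mult_exp, continuous_value. }
  replace (RInt (fun x => (1 + value a 0 r x) * exp x) 0 t)
    with (exp t - 1 + RInt (fun x => value a 0 r x * exp x) 0 t).
  - unfold frail_factor, value_star, star.
    rewrite Rmult_plus_distr_l, <- Rmult_assoc, <- exp_plus, Rplus_opp_r, exp_0; ring.
  - rewrite <- (is_RInt_unique _ _ _ _ (is_RInt_exp t)).
    rewrite <- (RInt_plus exp (fun x => value a 0 r x * exp x));
      [|now exists (exp t - 1); apply is_RInt_exp | exact IN].
    apply RInt_ext; intros x _.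
    change (exp x + value a 0 r x * exp x = (1 + value a 0 r x) * exp x); ring.
Qed.

Lemma frail_factor_at_0 (a : nat -> R) (r : nat) : frail_factor a r 0 = 1.
Proof.
  unfold frail_factor, value_star, star; rewrite RInt_point.
  change (1 + exp (- 0) * 0 = 1); ring.
Qed.

Lemma frail_factor_0 (a : nat -> R) (t : R) : frail_factor a 0 t = 1.
Proof.
  apply (Rmult_eq_reg_l (exp t)); [|apply Rgt_not_eq, exp_pos].
  rewrite exp_mult_frail_factor, (RInt_ext _ exp);
    [|intros x _; change ((1 + 0) * exp x = exp x); ring].
  rewrite (is_RInt_unique _ _ _ _ (is_RInt_exp t)); ring.
Qed.

(** * Monotone ratios, by induction on the ammunition *)

(** Cross-multiplied, so that it can be stated before positivity is known. Taking [r = 0] gives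
    monotonicity in time, taking [s = 0] monotonicity in ammunition. *)
Definition frail_ratios_nondecreasing (a : nat -> R) (m : nat) : Prop :=
  forall r r' s t, (r <= r' <= m)%nat -> 0 <= s -> s <= t ->
  frail_factor a r t * frail_factor a r' s <= frail_factor a r s * frail_factor a r' t.

Lemma frail_factor_mono_time (a : nat -> R) (m r : nat) (s t : R) :
  frail_ratios_nondecreasing a m -> (r <= m)%nat -> 0 <= s -> s <= t ->
  frail_factor a r s <= frail_factor a r t.
Proof.
  intros IH Hr Hs Hst; generalize (IH 0%nat r s t ltac:(lia) Hs Hst).
  rewrite !frail_factor_0; lra.
Qed.

Lemma frail_factor_ge_1 (a : nat -> R) (m r : nat) (t : R) :
  frail_ratios_nondecreasing a m -> (r <= m)%nat -> 0 <= t -> 1 <= frail_factor a r t.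
Proof.
  intros IH Hr Ht; rewrite <- (frail_factor_at_0 a r).
  apply (frail_factor_mono_time a m); auto; lra.
Qed.

Lemma frail_factor_mono_ammo (a : nat -> R) (m r r' : nat) (t : R) :
  frail_ratios_nondecreasing a m -> (r <= r' <= m)%nat -> 0 <= t ->
  frail_factor a r t <= frail_factor a r' t.
Proof.
  intros IH Hr Ht; generalize (IH r r' 0 t Hr ltac:(lra) Ht).
  rewrite !frail_factor_at_0; lra.
Qed.

(** The optimal expenditure remains available with one more missile. At least one missile is spent,
    so the factors involved have index at most [m]. *)
Lemma frail_value_mono_ammo (a : nat -> R) (m : nat) (t : R) :
  kill_prob a -> frail_ratios_nondecreasing a m -> 0 <= t ->
  0 <= value a 0 m t <= value a 0 (S m) t.
Proof.
  intros ha IH Ht; destruct m as [|m].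
  - generalize (frail_value_ge a 1 1 t ltac:(lia)) (kill_prob_ge0 a 1 ha).
    rewrite value_0, frail_factor_0; lra.
  - destruct (frail_value_attained a (S m) t ltac:(lia)) as [j [Hj ->]].
    generalize (frail_value_ge a (S (S m)) j t ltac:(lia)) (kill_prob_ge0 a j ha)
      (frail_factor_ge_1 a _ (S m - j) t IH ltac:(lia) Ht)
      (frail_factor_mono_ammo a _ (S m - j) (S (S m) - j) t IH ltac:(lia) Ht).
    intros; split; nra.
Qed.

Lemma frail_value_ratio_nondecreasing (a : nat -> R) (m : nat) (s t : R) :
  kill_prob a -> frail_ratios_nondecreasing a m -> 0 <= s -> s <= t ->
  (1 + value a 0 (S m) s) * (1 + value a 0 m t) <=
  (1 + value a 0 (S m) t) * (1 + value a 0 m s).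
Proof.
  intros ha IH Hs Hst; assert (Ht : 0 <= t) by lra.
  destruct (frail_value_attained a (S m) s ltac:(lia)) as [k [Hk Ek]].
  (* For [m = 0] nothing can be spent; [j = 0] serves instead because [a 0 = 0]. *)
  assert (J : exists j, (j <= m)%nat /\
    value a 0 m t = a j * frail_factor a (m - j) t /\
    a j * frail_factor a (m - j) s <= value a 0 m s).
  { destruct m as [|m].
    - exists 0%nat; rewrite !value_0, kill_prob_0 by exact ha.
      split; [lia | split; lra].
    - destruct (frail_value_attained a (S m) t ltac:(lia)) as [j [Hj Ej]].
      exists j; split; [lia | split; [exact Ej | apply frail_value_ge; lia]]. }
  destruct J as [j [Hj [Ej Hjs]]].
  assert (Hms := frail_value_mono_ammo a m s ha IH Hs).
  assert (HS := proj1 (frail_value_mono_ammo a m t ha IH Ht)).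
  assert (HSt := proj2 (frail_value_mono_ammo a m t ha IH Ht)).
  assert (Fs := frail_factor_ge_1 a m (S m - k) s IH ltac:(lia) Hs).
  assert (Gs := frail_factor_ge_1 a m (m - j) s IH ltac:(lia) Hs).
  assert (Fst := frail_factor_mono_time a m (S m - k) s t IH ltac:(lia) Hs Hst).
  assert (Gst := frail_factor_mono_time a m (m - j) s t IH ltac:(lia) Hs Hst).
  assert (ak := kill_prob_ge0 a k ha).
  assert (aj := kill_prob_ge0 a j ha).
  destruct (Nat.le_gt_cases k (S j)) as [Hkj | Hkj].
  - assert (Hr := IH (m - j)%nat (S m - k)%nat s t ltac:(lia) Hs Hst).
    assert (Hkt := frail_value_ge a (S m) k t Hk).
    rewrite Ek, Ej in *.
    set (F := frail_factor a (S m - k)) in *.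
    set (G := frail_factor a (m - j)) in *.
    apply Rle_trans with ((1 + a k * F t) * (1 + a j * G s)); [|apply Rmult_le_compat; nra].
    (* After expansion, products and linear terms are compared separately. *)
    assert (Hprod : a k * a j * (G t * F s) <= a k * a j * (G s * F t))
      by (apply Rmult_le_compat_l; [now apply Rmult_le_pos | exact Hr]).
    (* Multiplied by [G s], this follows from [a j * G s <= N(m,s) <= N(m+1,s) = a k * F s] and then
       from [Hr]. *)
    assert (Hlin : a j * (G t - G s) <= a k * (F t - F s)).
    { apply (Rmult_le_reg_l (G s)); [lra|].
      apply Rle_trans with ((G t - G s) * (a k * F s)).
      - generalize (Rmult_le_compat_l (G t - G s) (a j * G s) (a k * F s)
          ltac:(lra) ltac:(lra)); lra.
      - generalize (Rmult_le_compat_l (a k) _ _ ak Hr); lra. }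
    lra.
  (* From here [k] is one less than the optimal expenditure. The exchange keeps the missiles left at
     each time, hence the factors [F s] and [G t]. *)
  - destruct k as [|k]; [lia|].
    assert (HFG := frail_factor_mono_ammo a m (S m - S k) (m - j) s IH ltac:(lia) Hs).
    assert (Hjt := frail_value_ge a (S m) (S j) t ltac:(lia)).
    assert (Hks := frail_value_ge a m k s ltac:(lia)).
    assert (Hconc := kill_prob_concave a j k ha ltac:(lia)).
    assert (Hlog := kill_prob_log_concave a j k ha ltac:(lia)).
    assert (Hk' := kill_prob_le a k (S k) ha ltac:(lia)).
    assert (aj' := kill_prob_ge0 a (S j) ha).
    assert (ak' := kill_prob_ge0 a k ha).
    rewrite Ek, Ej.
    replace (S m - S k)%nat with (m - k)%nat in * by lia.
    replace (S m - S j)%nat with (m - j)%nat in * by lia.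
    set (F := frail_factor a (m - k)) in *.
    set (G := frail_factor a (m - j)) in *.
    apply Rle_trans with ((1 + a (S j) * G t) * (1 + a k * F s));
      [|apply Rmult_le_compat; nra].
    assert (Hprod : (F s * G t) * (a (S k) * a j) <= (F s * G t) * (a (S j) * a k))
      by (apply Rmult_le_compat_l; [apply Rmult_le_pos; lra | exact Hlog]).
    (* Concavity, together with [F s <= G s <= G t]. *)
    assert (Hlin : (a (S k) - a k) * F s <= (a (S j) - a j) * G t)
      by (apply Rmult_le_compat; lra).
    lra.
Qed.

Lemma frail_factor_ratio_step (a : nat -> R) (m : nat) (s t : R) :
  kill_prob a -> frail_ratios_nondecreasing a m -> 0 <= s -> s <= t ->
  frail_factor a m t * frail_factor a (S m) s <=
  frail_factor a m s * frail_factor a (S m) t.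
Proof.
  intros ha IH Hs Hst.
  assert (C : forall r x, continuous (fun x => (1 + value a 0 r x) * exp x) x).
  { intros r x; apply (continuous_mult_exp (fun x => 1 + value a 0 r x)).
    apply (continuous_plus (fun _ => 1)); [apply continuous_const | apply continuous_value]. }
  assert (H := ratio_of_integrals_nondecreasing
    (fun x => (1 + value a 0 m x) * exp x) (fun x => (1 + value a 0 (S m) x) * exp x)
    s t (C m) (C (S m))).
  rewrite <- !exp_mult_frail_factor in H.
  apply (Rmult_le_reg_l (exp s * exp t)); [apply Rmult_lt_0_compat; apply exp_pos|].
  enough (exp t * frail_factor a m t * (exp s * frail_factor a (S m) s) <=
    exp s * frail_factor a m s * (exp t * frail_factor a (S m) t)) by lra.
  apply H; [| | | exact Hs | exact Hst].
  - intros x Hx; generalize (frail_value_mono_ammo a m x ha IH Hx) (exp_pos x).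
    intros; apply Rmult_lt_0_compat; lra.
  - intros x Hx; generalize (frail_value_mono_ammo a m x ha IH Hx) (exp_pos x).
    intros; apply Rmult_le_compat_r; lra.
  - intros x y Hx Hxy.
    generalize (Rmult_le_compat_l (exp x * exp y) _ _
      ltac:(apply Rlt_le, Rmult_lt_0_compat; apply exp_pos)
      (frail_value_ratio_nondecreasing a m x y ha IH Hx Hxy)); lra.
Qed.

Lemma frail_ratios_nondecreasing_all (a : nat -> R) (m : nat) :
  kill_prob a -> frail_ratios_nondecreasing a m.
Proof.
  intros ha; induction m as [|m IH]; intros r r' s t Hr Hs Hst.
  - replace r with 0%nat by lia; replace r' with 0%nat by lia; rewrite !frail_factor_0; lra.
  - destruct (Nat.eq_dec r' (S m)) as [->|]; [|apply IH; auto; lia].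
    destruct (Nat.eq_dec r (S m)) as [->|]; [lra|].
    (* The ratio of factors [m+1] to [r] is the product of the ratios [m+1] to [m] and [m] to
       [r]. *)
    assert (H1 := IH r m s t ltac:(lia) Hs Hst).
    assert (H2 := frail_factor_ratio_step a m s t ha IH Hs Hst).
    assert (Hrt := frail_factor_ge_1 a m r t IH ltac:(lia) ltac:(lra)).
    assert (Hrs := frail_factor_ge_1 a m r s IH ltac:(lia) Hs).
    assert (Hms := frail_factor_ge_1 a m m s IH ltac:(lia) Hs).
    assert (Hmt := frail_factor_ge_1 a m m t IH ltac:(lia) ltac:(lra)).
    (* Positivity of factor [m+1] lies beyond [IH]; the step from time 0 bounds it below by factor
       [m]. *)
    assert (HSt := frail_factor_ratio_step a m 0 t ha IH ltac:(lra) ltac:(lra)).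
    rewrite !frail_factor_at_0 in HSt.
    apply (Rmult_le_reg_l (frail_factor a m t)); [lra|].
    generalize (Rmult_le_compat_l (frail_factor a r t) _ _ ltac:(lra) H2)
      (Rmult_le_compat_l (frail_factor a (S m) t) _ _ ltac:(lra) H1); lra.
Qed.

(** * Monotonicity of the optimal policy *)

Theorem theorem5p1 (a : nat -> R) (ha : kill_prob a) (n : nat) (hn : (1 <= n)%nat)
    (s t : R) (hs : 0 <= s) (hst : s <= t) :
  (K a 0 n t <= K a 0 n s)%nat.
Proof.
  destruct (K_spec a 0 n s hn) as [Hj [Ej _]].
  destruct (K_spec a 0 n t hn) as [Hk [Ek Hmin]].
  set (j := K a 0 n s) in *; set (k := K a 0 n t) in *.
  destruct (Nat.le_gt_cases k j) as [|Hlt]; [assumption|].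
  (* As [k] is the least optimum at [t], it suffices that [j] is optimal at [t] too. *)
  apply Hmin; [exact Hj|].
  assert (IH := frail_ratios_nondecreasing_all a n ha).
  apply Rle_antisym; [rewrite frail_spend; now apply frail_value_ge|].
  assert (Hs := frail_value_ge a n k s Hk).
  assert (Hr := IH (n - k)%nat (n - j)%nat s t ltac:(lia) hs hst).
  assert (F1 := frail_factor_ge_1 a n (n - k) s IH ltac:(lia) hs).
  assert (G1 := frail_factor_ge_1 a n (n - j) s IH ltac:(lia) hs).
  assert (F2 := frail_factor_ge_1 a n (n - k) t IH ltac:(lia) ltac:(lra)).
  rewrite <- Ej, frail_spend in Hs; rewrite <- Ek, !frail_spend.
  (* Optimality of [j] at [s] carries over to [t], since passing from [s] to [t] favours the choice
     that leaves more missiles. *)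
  apply (Rmult_le_reg_l (frail_factor a (n - k) s)); [lra|].
  generalize (Rmult_le_compat_l _ _ _ (kill_prob_ge0 a j ha) Hr)
    (Rmult_le_compat_l (frail_factor a (n - k) t) _ _ ltac:(lra) Hs); lra.
Qed.
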